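(* Let $H$ be a finite-dimensional Euclidean space, $X$ a random vector in $H$, and $H=H'\oplus H''$ an orthogonal decomposition into two linear subspaces $H',H''\subset H$ of dimensions $d_1,d_2\geq 1$. For the orthogonal projections $X'=\mathrm{Proj}_{H'}(X)$, $X''=\mathrm{Proj}_{H''}(X)$, we have $$\chi^2(X,Z)\geq\chi^2(X',Z')+\chi^2(X'',Z''),$$ where $Z,Z',Z''$ are standard normal random vectors in $H,H',H''$, respectively.
   Context: In a Euclidean space $E$ of dimension $d$ with norm $|\cdot|$, a standard normal vector $Z$ (mean zero, identity covariance operator) has density $\varphi(x)=(2\pi)^{-d/2}e^{-|x|^2/2}$. For a random vector $Y$ in $E$ with density $p$, $\chi^2(Y,Z)=\int_E\frac{p(x)^2}{\varphi(x)}\,dx-1=\int_E\frac{(p(x)-\varphi(x))^2}{\varphi(x)}\,dx\in[0,\infty]$; if $Y$ has no density, then $\chi^2(Y,Z)=\infty$. *)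

(* Defs.v *)
From HB Require Import structures.
From mathcomp Require Import all_boot all_order all_algebra.
From mathcomp Require Import all_classical all_reals all_analysis.

Set Implicit Arguments.
Unset Strict Implicit.
Unset Printing Implicit Defensive.
Import Order.TTheory GRing.Theory Num.Theory.
Local Open Scope classical_set_scope.
Local Open Scope ring_scope.

(* A Euclidean space is a [vectType R] together with an inner product
   [dot : {dot E for idfun}].  [subdot dot U] is the inner product induced on a
   linear subspace [U], viewed as the space [subvs_of U]. *)
Section induced_inner_product.
Context (R : realType) (E : vectType R) (dot : {dot E for idfun})
  (U : {vspace E}).

Definition subdot (u v : subvs_of U) : R := dot (vsval u) (vsval v).

Let subdot_linearl v : linear_for *%R (subdot^~ v).
Proof. by move=> a x y; rewrite /subdot [vsval (_ + _)]linearP/= linearPl. Qed.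

Let subdot_linearr u : linear_for (idfun \; *%R) (subdot u).
Proof. by move=> a x y; rewrite /subdot [vsval (_ + _)]linearP/= linearPr. Qed.

HB.instance Definition _ := @bilinear_isBilinear.Build R (subvs_of U)
  (subvs_of U) R *%R (idfun \; *%R) subdot
  (conj subdot_linearl subdot_linearr).

Let subdotC u v : subdot u v = (-1) ^+ false * idfun (subdot v u).
Proof. exact: hermC. Qed.

HB.instance Definition _ := isHermitianSesquilinear.Build R (subvs_of U)
  false idfun subdot subdotC.

Let subdot_gt0 u : u != 0 -> 0 < subdot u u.
Proof.
by move=> u0; apply: neq0_dnorm_gt0; rewrite -(inj_eq subvs_inj) linear0 in u0.
Qed.

HB.instance Definition _ := isDotProduct.Build R (subvs_of U) subdot subdot_gt0.

End induced_inner_product.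
Arguments subdot {R E} dot U u v.

Section euclidean_space.
Context (R : realType) (E : vectType R) (dot : {dot E for idfun}).

Definition enorm (x : E) : R := Num.sqrt (dot x x).

Definition eopen : set (set E) :=
  [set A | forall x, A x ->
     exists2 e : R, 0 < e & forall y, enorm (y - x) < e -> A y].

(* [E] with its Borel sigma-algebra. *)
Definition euclid (_ : {dot E for idfun}) : Type := E.

HB.instance Definition _ := Choice.on (euclid dot).
HB.instance Definition _ := isPointed.Build (euclid dot) (0 : E).
HB.instance Definition _ := @isMeasurable.Build (sigma_display eopen)
  (euclid dot) <<s eopen >> (@sigma_algebra0 _ setT eopen)
  (@sigma_algebraC (euclid dot) eopen) (@sigma_algebra_bigcup _ setT eopen).

End euclidean_space.

Fixpoint lebesgue_tuple (R : realType) (n : nat) :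
    set (n.-tuple (measurableTypeR R)) -> \bar R :=
  match n with
  | 0 => \d_ [tuple]
  | m.+1 => pushforward (@lebesgue_measure R \x @lebesgue_tuple R m)%E
              (fun p => [tuple of p.1 :: p.2])
  end.

Section chi2.
Context (R : realType) (E : vectType R) (dot : {dot E for idfun}).
Let d := \dim {: E}.

Definition onb : d.-tuple E :=
  xget [tuple 0 | _ < d] [set e : d.-tuple E | orthonormal dot e].

(* Image of the Lebesgue measure of R^d under the isometry given by an
   orthonormal basis; it does not depend on that basis. *)
Definition lebesgue_euclid : set (euclid dot) -> \bar R :=
  pushforward (@lebesgue_tuple R d)
    (fun t => (\sum_(i < d) tnth t i *: tnth onb i : E) : euclid dot).

Definition std_normal_pdf (x : euclid dot) : R :=
  (2 * pi) `^ (- (d%:R / 2)) * expR (- (enorm dot x ^+ 2 / 2)).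

Definition is_density (dT : measure_display) (T : measurableType dT)
    (P : probability T R) (Y : T -> euclid dot) (p : euclid dot -> R) : Prop :=
  [/\ measurable_fun setT p, forall x, 0 <= p x &
    forall A, measurable A ->
      P (Y @^-1` A) = (\int[lebesgue_euclid]_(x in A) (p x)%:E)%E].

(* chi^2(Y, Z) for [Z] standard normal in [E]: a density is unique almost
   everywhere, so the value does not depend on the one picked by [cid]. *)
Definition chi2_normal (dT : measure_display) (T : measurableType dT)
    (P : probability T R) (Y : T -> euclid dot) : \bar R :=
  match pselect (exists p, is_density P Y p) with
  | left h => let p := sval (cid h) in
      (\int[lebesgue_euclid]_x (p x ^+ 2 / std_normal_pdf x)%:E - 1)%E
  | right _ => +oo%E
  end.

End chi2.
Arguments chi2_normal {R E} dot {dT T} P Y.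

Definition orth_proj (R : realType) (E : vectType R) (dot : {dot E for idfun})
    (U : {vspace E}) (x : E) : subvs_of U :=
  vsproj U (daddv_pi U (orthov dot U) x).

(* Main.v *)
(* Let [p], [a], [b] be densities of [X], [X'], [X''] and [phi], [phiU], [phiV]
   the standard normal densities.  Since [phi = phiU * phiV] and Lebesgue
   measure on [H] is the product of those on [H'] and [H''], expanding
     0 <= \int phi * (p / phi - a / phiU - b / phiV + 1) ^ 2
   gives the inequality: the cross terms with [p] integrate to the second
   moments of [a / phiU] and [b / phiV], because [a] and [b] are the marginals
   of [p].  That Lebesgue measure, defined through an arbitrary orthonormal
   basis, is compatible with the decomposition follows from the uniqueness of
   translation-invariant measures, normalised by the Gaussian integral. *)
Require Import Defs.
From HB Require Import structures.
From mathcomp Require Import all_boot all_order all_algebra.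
From mathcomp Require Import all_classical all_reals all_analysis
  measurable_realfun ring lra.
Import Order.TTheory GRing.Theory Num.Theory.
Local Open Scope classical_set_scope.
Local Open Scope ring_scope.

(** * Orthonormal coordinates *)

Section OrthonormalBasis.
Context {R : realType} {E : vectType R} (dot : {dot E for idfun}).

(** The square is the squared distance, in [L^2] of the normal law, between [p / phi - 1] and
    [(a / phiU - 1) + (b / phiV - 1)]; the constant [1] in it is what remains of the three
    centrings. Under [phi] the two components are independent, so the two centred functions are
    orthogonal, and each is the projection of [p / phi - 1] onto the functions of one component. The
    inequality is thus Bessel's inequality.

    The obstacle is infinity. The second moments of [a / phiU] and [b / phiV] occur on both sides of
    the expansion and cancel only if finite. A separate bound, monotonicity of the chi-square
    integral under projection, controls each of them by the integral of [p ^ 2 / phi]: either that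
    one is infinite and nothing is left to prove, or everything is finite.

    Moreover the densities come from a choice operator, so [a] and [b] agree with the partial
    integrals of [p] only almost everywhere, and every identity is proved for arbitrary
    densities. *)

Lemma dotC (x y : E) : dot x y = dot y x.
Proof. by rewrite hermC /= expr0 mul1r. Qed.

Lemma orthonormal_cons (x : E) (s : seq E) :
  orthonormal dot (x :: s) =
  [&& dot x x == 1, all (fun y => dot x y == 0) s & orthonormal dot s].
Proof.
by rewrite /orthonormal /= /ortho_rec /= andbT -!andbA; congr (_ && _);
  rewrite andbCA.
Qed.

Lemma orthonormal_nth (s : seq E) (i j : nat) : orthonormal dot s ->
  (i < size s)%N -> (j < size s)%N -> dot s`_i s`_j = (i == j)%:R.
Proof.
elim: s i j => [//|x s IH] [|i] [|j];
  rewrite orthonormal_cons => /and3P[/eqP xx /allP xs os] /=.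
- by [].
- by move=> _ js; apply/eqP/xs/mem_nth.
- by move=> si _; rewrite dotC; apply/eqP/xs/mem_nth.
- by rewrite !ltnS => si sj; rewrite IH.
Qed.

(** Gram-Schmidt, one vector at a time: while [k] is below the dimension, some [x] lies outside the
    span of [s], and its component orthogonal to [s] can be normalised. *)
Lemma orthonormal_seq_exists (k : nat) : (k <= \dim {: E})%N ->
  exists2 s : seq E, size s = k & orthonormal dot s.
Proof.
elim: k => [_|k IH kd]; first by exists [::].
have [s ss os] := IH (ltnW kd).
have [x xs] : exists x, x \notin (span s).
  apply: contrapT => /forallNP H.
  have : (fullv <= span s)%VS.
    by apply/subvP => x _; apply/negPn/negP => /H.
  move/dimvS => dle; have := leq_trans dle (dim_span s).
  by rewrite ss leqNgt kd.
pose y := x - \sum_(i < size s) dot x s`_i *: s`_i.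
have y0 : y != 0.
  apply: contraNneq xs => /eqP; rewrite subr_eq0 => /eqP ->.
  by apply: memv_suml => i _; apply/memvZ/memv_span/mem_nth.
have ys j : (j < size s)%N -> dot y s`_j = 0.
  move=> js; rewrite /y linearBl linear_sumlz/= (bigD1 (Ordinal js))//=.
  rewrite linearZl_LR/= orthonormal_nth// eqxx mulr1 big1 ?addr0 ?subrr//.
  move=> i ij; rewrite linearZl_LR/= orthonormal_nth// (_ : _ == _ = false)
    ?mulr0//.
  by apply/negbTE; apply: contra ij => /eqP ij; apply/eqP/val_inj.
have yy : 0 < dot y y by exact: neq0_dnorm_gt0.
exists ((Num.sqrt (dot y y))^-1 *: y :: s); first by rewrite /= ss.
rewrite orthonormal_cons os andbT; apply/andP; split.
  rewrite linearZl_LR linearZr_LR/= mulrA -expr2 exprVn sqr_sqrtr ?(ltW yy)//.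
  by rewrite mulVf// gt_eqF.
apply/allP => _ /(nthP 0)[j js <-].
by rewrite linearZl_LR/= ys ?mulr0.
Qed.

Let d := \dim {: E}.
Let e := onb dot.

(** Existence of an orthonormal family of length [d] rules out the zero tuple that [xget] returns by
    default. *)
Lemma onb_orthonormal : orthonormal dot e.
Proof.
rewrite /e /onb; case: xgetP => [_ _ //|];
  have [s ss os] := orthonormal_seq_exists d (leqnn d).
have sd : size s == d by apply/eqP.
by move=> /(_ (Tuple sd))/(_ os).
Qed.

Lemma dot_onb (i j : 'I_d) : dot (tnth e i) (tnth e j) = (i == j)%:R.
Proof.
by rewrite !(tnth_nth 0) orthonormal_nth ?size_tuple//; exact: onb_orthonormal.
Qed.

Definition of_coord (t : d.-tuple R) : E := \sum_(i < d) tnth t i *: tnth e i.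

Definition coord_of (x : E) : d.-tuple R := [tuple dot x (tnth e i) | i < d].

Lemma of_coordK : cancel of_coord coord_of.
Proof.
move=> t; apply: eq_from_tnth => i;
  rewrite tnth_mktuple /of_coord linear_sumlz/=.
rewrite (bigD1 i)//= linearZl_LR/= dot_onb eqxx mulr1 big1 ?addr0// => j ji.
by rewrite linearZl_LR/= dot_onb (negbTE ji) mulr0.
Qed.

Lemma coord_ofK : cancel coord_of of_coord.
Proof.
(* Orthonormality makes [e] free, and a free family of [d] vectors is a basis. Hence [of_coord] is
   onto, and its left inverse is two-sided. *)
have fe : free e.
  apply/freeP => k k0 i; have := congr1 (dot^~ (tnth e i)) k0.
  rewrite linear0l => <-; rewrite linear_sumlz/= (bigD1 i)//= linearZl_LR/=.
  rewrite -tnth_nth dot_onb eqxx mulr1 big1 ?addr0// => j ji.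
  by rewrite linearZl_LR/= -tnth_nth dot_onb (negbTE ji) mulr0.
have be : basis_of fullv e by rewrite basisEfree fe subvf size_tuple leqnn.
move=> x; have -> : x = of_coord [tuple coord e i x | i < d].
  rewrite {1}(coord_basis be (memvf x)); apply: eq_bigr => i _.
  by rewrite tnth_mktuple -tnth_nth.
by rewrite of_coordK.
Qed.

Lemma of_coordD t u : of_coord t + of_coord u =
    of_coord [tuple tnth t i + tnth u i | i < d].
Proof.
rewrite /of_coord -big_split; apply: eq_bigr => i _ /=.
by rewrite -scalerDl tnth_mktuple.
Qed.

Lemma dot_of_coord t :
  dot (of_coord t) (of_coord t) = \sum_(i < d) tnth t i ^+ 2.
Proof.
rewrite {2}/of_coord linear_sumr/=; apply: eq_bigr => i _.
rewrite linearZr_LR/= expr2; congr (_ * _).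
by rewrite -{2}(of_coordK t) tnth_mktuple.
Qed.

End OrthonormalBasis.

(** * Borel measurability of the coordinate maps *)

Section BorelCoordinates.
Context {R : realType} {E : vectType R} (dot : {dot E for idfun}).
Let d := \dim {: E}.

Lemma dot_ge0 (x : E) : 0 <= dot x x.
Proof.
by rewrite -[x](coord_ofK dot) dot_of_coord; apply: sumr_ge0 => i _;
  exact: sqr_ge0.
Qed.

Lemma enormE x : enorm dot x ^+ 2 = \sum_(i < d) tnth (coord_of dot x) i ^+ 2.
Proof.
by rewrite sqr_sqrtr ?dot_ge0// -(dot_of_coord dot) coord_ofK.
Qed.

Lemma enorm_ge0 x : 0 <= enorm dot x. Proof. exact: sqrtr_ge0. Qed.

Lemma enorm_lt x (r : R) : 0 < r ->
  (enorm dot x < r) = (\sum_(i < d) tnth (coord_of dot x) i ^+ 2 < r ^+ 2).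
Proof. by move=> r0; rewrite -enormE ltr_pXn2r// nnegrE ?enorm_ge0 ?ltW. Qed.

Lemma coord_ofB x y i :
  tnth (coord_of dot (x - y)) i =
    tnth (coord_of dot x) i - tnth (coord_of dot y) i.
Proof. by rewrite !tnth_mktuple linearBl. Qed.

Lemma coord_ofD x y i :
  tnth (coord_of dot (x + y)) i =
    tnth (coord_of dot x) i + tnth (coord_of dot y) i.
Proof. by rewrite !tnth_mktuple linearDl. Qed.

Lemma coord_le_enorm x i : `|tnth (coord_of dot x) i| <= enorm dot x.
Proof.
rewrite -(ler_pXn2r (n := 2))// ?nnegrE ?enorm_ge0//
  enormE real_normK ?num_real//.
by rewrite (bigD1 i)//= lerDl sumr_ge0// => j _; exact: sqr_ge0.
Qed.

(** A coordinate changes by at most the norm of the displacement, so the preimage of an open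
    half-line is open in the sense of [eopen]. *)
Lemma measurable_coord_of :
  measurable_fun setT (coord_of dot : euclid dot ->
    d.-tuple (measurableTypeR R)).
Proof.
apply/measurable_fun_tnthP => i.
apply: (measurability _ (RGenOInfty.measurableE R)) => _ [_ [a ->] <-].
rewrite setTI; apply: sub_sigma_algebra => x /=; rewrite in_itv/= andbT => ax.
exists (tnth (coord_of dot x) i - a); first by rewrite subr_gt0.
move=> y yx; rewrite in_itv/= andbT.
have := le_lt_trans (coord_le_enorm (y - x) i) yx.
rewrite coord_ofB ltr_norml => /andP[+ _].
by rewrite opprB ltrBDr subrK.
Qed.

(** Coordinatewise [(s + t) ^ 2 <= 2 * (s ^ 2 + t ^ 2)]. This crude bound stands in for the triangle
    inequality in the covering by small balls. *)
Lemma enormD_sqr_le x y :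
  enorm dot (x + y) ^+ 2 <= 2 * (enorm dot x ^+ 2 + enorm dot y ^+ 2).
Proof.
rewrite !enormE -big_split/= mulr_sumr; apply: ler_sum => i _.
rewrite coord_ofD; set a := tnth _ _; set b := tnth _ _.
by rewrite -subr_ge0; apply: le_trans (sqr_ge0 (a - b)) _; rewrite sqrrB sqrrD;
  lra.
Qed.

Lemma enormN x : enorm dot (- x) = enorm dot x.
Proof. by rewrite /enorm linearNl linearNr opprK. Qed.

Lemma measurable_enorm_of_coord (x : E) :
  measurable_fun setT (fun t : d.-tuple (measurableTypeR R) =>
    \sum_(i < d) (tnth t i - tnth (coord_of dot x) i) ^+ 2).
Proof.
apply: measurable_sum => i; apply: measurable_funX.
by apply: measurable_funB => //; exact: measurable_tnth.
Qed.

Lemma rat_coord_dense (x : E) (r : R) : 0 < r ->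
  exists q : d.-tuple rat,
    enorm dot (x - of_coord dot [tuple ratr (tnth q i) | i < d]) < r.
Proof.
(* With this precision the squared errors add up to [d * r ^ 2 / (d + 1) ^ 2 < r ^ 2]; dividing by
   [d + 1] also covers dimension zero. *)
move=> r0; pose e := r / d.+1%:R.
have e0 : 0 < e by rewrite divr_gt0.
have /choice[q qP] (i : 'I_d) :
    exists q : rat, `|tnth (coord_of dot x) i - ratr q| < e.
  have /rat_in_itvoo[q] :
      tnth (coord_of dot x) i - e < tnth (coord_of dot x) i + e.
    by rewrite ltrBlDr -addrA ltrDl addr_gt0.
  rewrite in_itv/= => /andP[]; set a := tnth _ _; exists q.
  by rewrite ltr_norml; apply/andP; split; lra.
exists [tuple q i | i < d]; rewrite enorm_lt//.
apply: (@le_lt_trans _ _ (\sum_(i < d) e ^+ 2)).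
  apply: ler_sum => i _; rewrite coord_ofB of_coordK !tnth_mktuple.
  rewrite -real_normK ?num_real// ler_pXn2r ?nnegrE ?(ltW e0)//.
  by have := ltW (qP i); rewrite tnth_mktuple.
rewrite sumr_const card_ord -mulr_natr /e expr_div_n -mulrA gtr_pMr
  ?exprn_gt0//.
rewrite mulrC ltr_pdivrMr ?exprn_gt0// mul1r -natrX ltr_nat.
by rewrite expnS expn1 mulSn leq_addr.
Qed.

(** The sigma-algebra on tuples is generated by coordinates, not by open sets, so openness is
    reduced to countably many conditions: an open set is the union of the balls [B (q, n)], of
    rational centre and radius [1 / (n + 1)], that it contains. *)
Lemma measurable_of_coord :
  measurable_fun setT (of_coord dot : d.-tuple (measurableTypeR R) ->
    euclid dot).
Proof.
apply: (@measurability _ _ _ (euclid dot) setT _ (eopen dot) erefl) =>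
  _ [A oA <-]; rewrite setTI.
pose c (q : d.-tuple rat) : E := of_coord dot [tuple ratr (tnth q i) | i < d].
pose B (qn : d.-tuple rat * nat) :=
  [set x : E | enorm dot (x - c qn.1) < qn.2.+1%:R^-1].
pose F qn := if `[< B qn `<=` A >] then of_coord dot @^-1` B qn else set0.
have -> : of_coord dot @^-1` A = \bigcup_qn F qn.
  apply/seteqP; split=> [t At|t [qn _]]; last first.
    by rewrite /F; case: asboolP => // BA /BA.
  have [e e0 eA] := oA _ At.
  (* Two points within [r] of the same centre are at squared distance at most
     [2 * (r ^ 2 + r ^ 2) = (2 * r) ^ 2], by [enormD_sqr_le]. *)
  have [n n0 ne] : exists2 n : nat, 0 < n.+1%:R^-1 :> R &
      (2 * n.+1%:R^-1) ^+ 2 < e ^+ 2 :> R.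
    exists (Num.truncn (2 / e)); first by rewrite invr_gt0.
    rewrite ltr_pXn2r ?nnegrE ?(ltW e0)//.
    by rewrite ltr_pdivrMr// mulrC -ltr_pdivrMr// truncnS_gt.
  have [q qx] := rat_coord_dense (of_coord dot t) _ n0.
  exists (q, n) => //; rewrite /F; case: asboolP => // -[] y /= yq.
  apply: eA; rewrite -(ltr_pXn2r (n := 2)) ?nnegrE ?enorm_ge0 ?(ltW e0)//.
  apply: le_lt_trans ne.
  rewrite -[y - _](subrKA (c q)) exprMn [2 ^+ 2]expr2.
  apply: le_trans (enormD_sqr_le _ _) _.
  rewrite -(mulrA 2 2) ler_pM2l// mulrDl mul1r.
  rewrite lerD ?ler_pXn2r ?nnegrE ?enorm_ge0 ?(ltW n0)// ?ltW//.
  by rewrite -enormN opprB.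
apply: countable_bigcupT_measurable => [|[q n]]; first exact: countableP.
rewrite /F; case: asboolP => // _.
have -> : of_coord dot @^-1` B (q, n) =
  (fun t => \sum_(i < d) (tnth t i - tnth (coord_of dot (c q)) i) ^+ 2) @^-1`
     [set` `]-oo, n.+1%:R^-1 ^+ 2[].
  apply/funext => t; rewrite /preimage /B/= in_itv/= enorm_lt ?invr_gt0//.
  by congr (_ < _); apply: eq_bigr => i _; rewrite coord_ofB of_coordK.
rewrite -[X in measurable X]setTI.
exact: measurable_enorm_of_coord.
Qed.

End BorelCoordinates.

(** * Lebesgue measure *)

Section SigmaFinite.
Context {d1 d2} {T1 : measurableType d1} {T2 : measurableType d2}
  {R : realType}.
Local Open Scope ereal_scope.

(** Tonelli's theorem is applied to bundled sigma-finite measures; this bundles a measure whose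
    sigma-finiteness is only a proof, without changing its values. *)
Lemma sigma_finite_measureP (m : {measure set T1 -> \bar R}) :
  sigma_finite setT m ->
  exists m' : {sigma_finite_measure set T1 -> \bar R},
    m = m' :> (set T1 -> \bar R).
Proof.
move=> sf.
pose sfin := isSFinite.Build _ _ _ _ (sfinite_measure_sigma_finite sf).
pose sigfin := isSigmaFinite.Build _ _ _ _ sf.
by exists (HB.pack_for (SigmaFiniteMeasure.type T1 R) (Measure.sort m)
  sfin sigfin).
Qed.

(* The canonical measure structure takes the measurability of [f] as an argument
   that unification cannot guess. *)
Definition pushforward_measure (m : {measure set T1 -> \bar R}) (f : T1 -> T2)
    (mf : measurable_fun setT f) : {measure set T2 -> \bar R} :=
  measure_function_pushforward__canonical__measure_function_Measure m mf.

(** A pushforward can lose sigma-finiteness. The left inverse [g] prevents this: it pulls an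
    exhaustion of [T1] back to [T2], and pulling that back along [f] restores the original sets. *)
Lemma sigma_finite_pushforward (m : {measure set T1 -> \bar R})
    (f : T1 -> T2) (g : T2 -> T1) :
  measurable_fun setT g -> cancel f g ->
  sigma_finite setT m -> sigma_finite setT (pushforward m f).
Proof.
move=> mg fK [F FT Ffin].
exists (fun i => g @^-1` F i) => [|i]; first by rewrite -preimage_bigcup -FT.
have [mF Fi] := Ffin i; split.
  by rewrite -[X in measurable X]setTI; exact: mg.
rewrite /pushforward -comp_preimage (_ : g \o f = id)//.
by apply/funext => x /=; rewrite fK.
Qed.

(* The library instance for [\x] covers finite measures only. *)
Lemma sigma_finite_product (m1 : {sigma_finite_measure set T1 -> \bar R})
    (m2 : {sigma_finite_measure set T2 -> \bar R}) :
  sigma_finite setT (m1 \x m2).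
Proof.
have /sigma_finiteP[F [FT ndF Ffin]] := sigma_finiteT m1.
have /sigma_finiteP[G [GT ndG Gfin]] := sigma_finiteT m2.
exists (fun n => F n `*` G n) => [|n]; last first.
  have [[mF F_fin] [mG G_fin]] := (Ffin n, Gfin n).
  split; first exact: measurableX.
  by rewrite product_measure1E// lte_mul_pinfty// ge0_fin_numE.
apply/esym/seteqP; split=> // -[x y] _.
have : [set: T1] x by []. rewrite FT => -[i _ Fx].
have : [set: T2] y by []. rewrite GT => -[j _ Gy].
exists (maxn i j) => //; split.
- by move/subsetPset : (ndF _ _ (leq_maxl i j)); exact.
- by move/subsetPset : (ndG _ _ (leq_maxr i j)); exact.
Qed.

(** The bundled measure is provided by a propositional existential, which cannot be opened to build
    a structure; these properties are propositions, so they can be extracted from it. *)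
Lemma sigma_finite_measure_axioms (mu : set T1 -> \bar R)
    (m : {sigma_finite_measure set T1 -> \bar R}) : mu = m ->
  [/\ mu set0 = 0, forall A, 0 <= mu A, semi_sigma_additive mu &
      sigma_finite setT mu].
Proof.
by move=> ->; split=> //;
  [exact: measure_semi_sigma_additive|exact: sigma_finiteT].
Qed.

End SigmaFinite.

(** * Lebesgue measure on tuples: Tonelli, translations, Gaussian integral *)

Section LebesgueTuple.
Context (R : realType).
Local Open Scope ereal_scope.
Local Notation RR := (measurableTypeR R).

Definition cons_pair n (p : RR * n.-tuple RR) : n.+1.-tuple RR :=
  [tuple of p.1 :: p.2].

Definition uncons_pair n (t : n.+1.-tuple RR) : RR * n.-tuple RR :=
  (thead t, [tuple of behead t]).

Lemma cons_pairK n : cancel (@cons_pair n) (@uncons_pair n).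
Proof. by move=> [x t]; congr pair; apply: val_inj. Qed.

Lemma measurable_cons_pair n : measurable_fun setT (@cons_pair n).
Proof. exact: measurable_cons. Qed.

Lemma measurable_uncons_pair n : measurable_fun setT (@uncons_pair n).
Proof.
apply: measurable_fun_pair; [exact: measurable_tnth|exact: measurable_behead].
Qed.

(** The induction must carry sigma-finiteness along, since [sigma_finite_product] requires it of
    both factors. *)
Lemma lebesgue_tuple_is_measure n :
  exists m : {sigma_finite_measure set (n.-tuple RR) -> \bar R},
    @lebesgue_tuple R n = m.
Proof.
elim: n => [|n [m mE]].
  by exists (\d_[tuple] : {sigma_finite_measure set (0.-tuple RR) -> \bar R}).
pose push := pushforward_measure (lebesgue_measure \x m) (@cons_pair n)
  (@measurable_cons_pair n).
have [|m' m'E] := sigma_finite_measureP push.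
  exact: sigma_finite_pushforward (@measurable_uncons_pair n) (@cons_pairK n)
    (sigma_finite_product _ _).
by exists m'; rewrite -m'E /= mE.
Qed.

Let axioms n := let: ex_intro m h := lebesgue_tuple_is_measure n in
  sigma_finite_measure_axioms _ m h.

HB.instance Definition _ n := isMeasure.Build _ _ _ (@lebesgue_tuple R n)
  (let: And4 h _ _ _ := axioms n in h) (let: And4 _ h _ _ := axioms n in h)
  (let: And4 _ _ h _ := axioms n in h).

HB.instance Definition _ n :=
  Measure_isSigmaFinite.Build _ _ _ (@lebesgue_tuple R n)
  (let: And4 _ _ _ h := axioms n in h).

Lemma ge0_integral_lebesgue_tupleS n (f : n.+1.-tuple RR -> \bar R) :
  measurable_fun setT f -> (forall t, 0 <= f t) ->
  \int[@lebesgue_tuple R n.+1]_t f t =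
  \int[lebesgue_measure]_x \int[@lebesgue_tuple R n]_t f (cons_pair n (x, t)).
Proof.
move=> mf f0; rewrite /= ge0_integral_pushforward//;
  last exact: measurable_cons_pair.
rewrite preimage_setT fubini_tonelli1//.
  apply: measurableT_comp => //; exact: measurable_cons_pair.
by move=> p; exact: f0.
Qed.

Definition shift_tuple {n} (a t : n.-tuple RR) : n.-tuple RR :=
  [tuple tnth t i + tnth a i | i < n]%R.

Lemma measurable_shift_tuple {n} (a : n.-tuple RR) :
    measurable_fun setT (shift_tuple a).
Proof.
apply/measurable_fun_tnthP => i.
rewrite (_ : _ \o _ = (fun t => tnth t i + tnth a i)%R); last first.
  by apply/funext => t /=; rewrite tnth_mktuple.
by apply: measurable_funD => //; exact: measurable_tnth.
Qed.

Lemma shift_cons_pair n (a : n.+1.-tuple RR) x (t : n.-tuple RR) :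
  shift_tuple a (cons_pair n (x, t)) =
  cons_pair n ((x + thead a)%R, shift_tuple [tuple of behead a] t).
Proof.
apply: eq_from_tnth => i; rewrite tnth_mktuple.
have [j ->|->] := unliftP ord0 i; last by rewrite !tnth0.
by rewrite !tnthS tnth_mktuple {1}(tuple_eta a) tnthS.
Qed.

Lemma ge0_integral_lebesgue_shift (f : RR -> \bar R) (a : R) :
  measurable_fun setT f -> (forall x, 0 <= f x) ->
  \int[lebesgue_measure]_x f (x + a)%R = \int[lebesgue_measure]_x f x.
Proof.
move=> mf f0; pose s : RR -> RR := fun x => (x + a)%R.
have ms : measurable_fun setT s by exact: measurable_funD.
pose push := pushforward_measure lebesgue_measure s ms.
transitivity (\int[push]_x f x).
  by rewrite ge0_integral_pushforward.
(* Lebesgue measure is determined by its values on half-open intervals, whose lengths a translation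
   preserves. *)
apply: eq_measure_integral => A mA _; apply/esym/lebesgue_measure_unique => //.
move=> _ [[u v]] _ <-; rewrite /push/= /pushforward_measure/= /pushforward.
have -> : s @^-1` `]u, v] = `](u - a)%R, (v - a)%R]%classic.
  by apply/seteqP; split=> x /=; rewrite !in_itv/= /s ltrBlDr lerBrDr.
rewrite !lebesgue_measure_itv/= !lte_fin ltrD2r.
by case: ifP => // _; rewrite -!EFinD; congr EFin; ring.
Qed.

(** Tonelli separates the head of the tuple: the one-dimensional case translates the head, the
    induction hypothesis translates the tail inside the outer integral. *)
Lemma ge0_integral_lebesgue_tuple_shift n (a : n.-tuple RR)
    (f : n.-tuple RR -> \bar R) :
  measurable_fun setT f -> (forall t, 0 <= f t) ->
  \int[@lebesgue_tuple R n]_t f (shift_tuple a t) =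
    \int[@lebesgue_tuple R n]_t f t.
Proof.
elim: n a f => [|n IH] a f mf f0.
  by apply: eq_integral => t _; rewrite (tuple0 t) (tuple0 (shift_tuple _ _)).
have mfc : measurable_fun setT (f \o cons_pair n).
  by apply: measurableT_comp => //; exact: measurable_cons_pair.
rewrite !ge0_integral_lebesgue_tupleS//; last first.
  by apply: measurableT_comp => //; exact: measurable_shift_tuple.
pose F x := \int[@lebesgue_tuple R n]_t f (cons_pair n (x, t)).
rewrite -[RHS](ge0_integral_lebesgue_shift F (thead a)).
- apply: eq_integral => x _; rewrite /F.
  rewrite -[RHS](IH [tuple of behead a])//.
    by apply: eq_integral => t _; rewrite shift_cons_pair.
  apply: (measurableT_comp (f := f \o cons_pair n)
    (g := fun t => ((x + thead a)%R, t))) => //.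
  exact: measurable_fun_pair.
- exact: (@measurable_fun_fubini_tonelli_F _ _ _ _ _ (@lebesgue_tuple R n)
    (f \o cons_pair n) mfc (fun=> f0 _)).
- by move=> x; exact: integral_ge0.
Qed.

Lemma integral_prod_normal_pdf n :
  \int[@lebesgue_tuple R n]_t (\prod_(i < n) normal_pdf 0 1 (tnth t i))%:E = 1.
Proof.
elim: n => [|n IH].
  under eq_integral do rewrite big_ord0.
  by rewrite integral_cst// mul1e; exact: diracT.
rewrite ge0_integral_lebesgue_tupleS; last first.
- by move=> t; rewrite lee_fin; apply: prodr_ge0 => i _; exact: normal_pdf_ge0.
- apply/measurable_EFinP; apply: measurable_prod => i _.
  by apply: measurableT_comp;
    [exact: measurable_normal_pdf|exact: measurable_tnth].
rewrite -(integral_normal_pdf (0 : R) 1); apply: eq_integral => x _.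
pose g (t : n.-tuple RR) := (\prod_(i < n) normal_pdf 0 1 (tnth t i))%R : R.
transitivity (\int[@lebesgue_tuple R n]_t ((normal_pdf 0 1 x)%:E * (g t)%:E)).
  apply: eq_integral => t _; rewrite big_ord_recl EFinM tnth0/=.
  by congr (_ * _%:E); apply: eq_bigr => i _; rewrite tnthS.
rewrite ge0_integralZl//; first by rewrite IH mule1.
- apply/measurable_EFinP; apply: measurable_prod => i _.
  by apply: measurableT_comp;
    [exact: measurable_normal_pdf|exact: measurable_tnth].
- by move=> t _; rewrite lee_fin; apply: prodr_ge0 => i _;
    exact: normal_pdf_ge0.
- by rewrite lee_fin normal_pdf_ge0.
Qed.

End LebesgueTuple.

(** * Lebesgue measure and the normal density on a Euclidean space *)

Section LebesgueEuclid.
Context {R : realType} {E : vectType R} (dot : {dot E for idfun}).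
Let d := \dim {: E}.
Local Open Scope ereal_scope.
Local Notation RR := (measurableTypeR R).

Lemma lebesgue_euclid_is_measure :
  exists m : {sigma_finite_measure set (euclid dot) -> \bar R},
    @lebesgue_euclid R E dot = m.
Proof.
pose push := pushforward_measure (@lebesgue_tuple R d)
  (of_coord dot : d.-tuple RR -> euclid dot) (measurable_of_coord dot).
have [|m mE] := sigma_finite_measureP push; last by exists m; rewrite -mE.
exact: sigma_finite_pushforward (measurable_coord_of dot) (of_coordK dot)
  (sigma_finiteT _).
Qed.

Let axioms := let: ex_intro m h := lebesgue_euclid_is_measure in
  sigma_finite_measure_axioms _ m h.

HB.instance Definition _ := isMeasure.Build _ _ _ (@lebesgue_euclid R E dot)
  (let: And4 h _ _ _ := axioms in h) (let: And4 _ h _ _ := axioms in h)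
  (let: And4 _ _ h _ := axioms in h).

HB.instance Definition _ :=
  Measure_isSigmaFinite.Build _ _ _ (@lebesgue_euclid R E dot)
  (let: And4 _ _ _ h := axioms in h).

Lemma ge0_integral_lebesgue_euclid (f : euclid dot -> \bar R) :
  measurable_fun setT f -> (forall x, 0 <= f x) ->
  \int[@lebesgue_euclid R E dot]_x f x =
    \int[@lebesgue_tuple R d]_t f (of_coord dot t).
Proof.
move=> mf f0; rewrite [LHS](ge0_integral_pushforward
  (measurable_of_coord dot))//.
Qed.

Lemma measurable_to_euclid {d'} {T : measurableType d'} (f : T -> E) :
  (forall i, measurable_fun setT (fun x => tnth (coord_of dot (f x)) i)) ->
  measurable_fun setT (f : T -> euclid dot).
Proof.
move=> mf; rewrite (_ : f = of_coord dot \o (coord_of dot \o f)); last first.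
  by apply/funext => x /=; rewrite coord_ofK.
apply: measurableT_comp (measurable_of_coord dot) _.
exact/measurable_fun_tnthP.
Qed.

Lemma measurable_coord i :
    measurable_fun setT (fun x : euclid dot => tnth (coord_of dot x) i).
Proof.
exact: measurableT_comp (measurable_tnth i) (measurable_coord_of dot).
Qed.

Lemma measurable_add_euclid {d'} {T : measurableType d'} (f g : T -> E) :
  measurable_fun setT (f : T -> euclid dot) ->
    measurable_fun setT (g : T -> euclid dot) ->
  measurable_fun setT ((fun x => f x + g x)%R : T -> euclid dot).
Proof.
move=> mf mg; apply: measurable_to_euclid => i.
rewrite (_ : (fun _ => _) =
  (fun x => tnth (coord_of dot (f x)) i + tnth (coord_of dot (g x)) i)%R).
  apply: measurable_funD.
    exact: measurableT_comp (measurable_coord i) mf.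
  exact: measurableT_comp (measurable_coord i) mg.
by apply/funext => x; rewrite coord_ofD.
Qed.

Lemma measurable_opp_euclid {d'} {T : measurableType d'} (f : T -> E) :
  measurable_fun setT (f : T -> euclid dot) ->
  measurable_fun setT ((fun x => - f x)%R : T -> euclid dot).
Proof.
move=> mf; apply: measurable_to_euclid => i.
rewrite (_ : (fun _ => _) = (fun x => - tnth (coord_of dot (f x)) i)%R).
  by apply: measurable_funN; exact: measurableT_comp (measurable_coord i) mf.
by apply/funext => x; rewrite -[in LHS](sub0r (f x))
  coord_ofB tnth_mktuple linear0l sub0r.
Qed.

Lemma measurable_shift_euclid (a : E) :
  measurable_fun setT ((fun x : euclid dot => x + a : E)%R : euclid dot ->
    euclid dot).
Proof.
by apply: (@measurable_add_euclid _ (euclid dot) id (fun=> a)) => //;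
  exact: measurable_cst.
Qed.

Lemma measurable_reflect_euclid (a : E) :
  measurable_fun setT ((fun x : euclid dot => a - x : E)%R : euclid dot ->
    euclid dot).
Proof.
apply: (@measurable_add_euclid _ (euclid dot) (fun=> a));
  first exact: measurable_cst.
exact: (@measurable_opp_euclid _ (euclid dot) id).
Qed.

Lemma ge0_integral_lebesgue_euclid_shift (a : E) (f : euclid dot -> \bar R) :
  measurable_fun setT f -> (forall x, 0 <= f x) ->
  \int[@lebesgue_euclid R E dot]_x f (x + a : E)%R =
    \int[@lebesgue_euclid R E dot]_x f x.
Proof.
move=> mf f0; rewrite !ge0_integral_lebesgue_euclid//; last first.
  exact: (measurableT_comp mf (measurable_shift_euclid _)).
rewrite -[RHS](ge0_integral_lebesgue_tuple_shift _ _ (coord_of dot a))//.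
  apply: eq_integral => t _; congr f; rewrite -{1}(coord_ofK dot a) of_coordD//.
by apply: measurableT_comp mf (measurable_of_coord dot).
Qed.

Lemma std_normal_pdf_gt0 x : (0 < @std_normal_pdf R E dot x)%R.
Proof.
by rewrite /std_normal_pdf mulr_gt0 ?expR_gt0 ?powR_gt0 ?mulr_gt0 ?pi_gt0.
Qed.

Lemma std_normal_pdf_ge0 x : (0 <= @std_normal_pdf R E dot x)%R.
Proof. exact/ltW/std_normal_pdf_gt0. Qed.

(** The squared norm is the sum of the squared coordinates, and the normalising constant is the
    [d]-th power of the one-dimensional peak [1 / sqrt (2 * pi)]. *)
Lemma std_normal_pdf_of_coord (t : d.-tuple R) :
  (@std_normal_pdf R E dot (of_coord dot t) =
    \prod_(i < d) normal_pdf 0 1 (tnth t i))%R.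
Proof.
under eq_bigr do rewrite normal_pdfE ?oner_neq0//.
rewrite big_split/= prodr_const card_ord -expR_sum /std_normal_pdf.
congr (_ * expR _)%R.
  rewrite /normal_peak expr1n mul1r -(mulr_natl pi)
    -powR12_sqrt ?mulr_ge0 ?pi_ge0//.
  rewrite -powRN -powR_mulrn ?powR_ge0// -powRrM.
  by congr (_ `^ _)%R; field.
rewrite enormE -mulNr -sumrN mulr_suml; apply: eq_bigr => i _.
by rewrite of_coordK subr0 expr1n.
Qed.

Lemma measurable_std_normal_pdf : measurable_fun setT (@std_normal_pdf R E dot).
Proof.
rewrite (_ : @std_normal_pdf R E dot = fun x =>
  (\prod_(i < d) normal_pdf 0 1 (tnth (coord_of dot x) i))%R).
  apply: measurable_prod => i _; apply: measurableT_comp;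
    first exact: measurable_normal_pdf.
  exact: measurable_coord.
by apply/funext => x; rewrite -{1}(coord_ofK dot x) std_normal_pdf_of_coord.
Qed.

Lemma integral_std_normal_pdf :
    \int[@lebesgue_euclid R E dot]_x (@std_normal_pdf R E dot x)%:E = 1.
Proof.
rewrite ge0_integral_lebesgue_euclid; last first.
- by move=> x; rewrite lee_fin std_normal_pdf_ge0.
- by apply/measurable_EFinP; exact: measurable_std_normal_pdf.
rewrite -(integral_prod_normal_pdf R d).
by apply: eq_integral => t _; rewrite std_normal_pdf_of_coord.
Qed.

Lemma std_normal_pdfN x :
  @std_normal_pdf R E dot (- x : E)%R = @std_normal_pdf R E dot x.
Proof. by rewrite /std_normal_pdf enormN. Qed.

(** Phrased with integrals of nonnegative functions rather than measures of sets, because invariance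
    is used as a substitution inside iterated integrals. *)
Definition translation_invariant (mu : set (euclid dot) -> \bar R) :=
  forall (a : E) (f : euclid dot -> \bar R),
  measurable_fun setT f -> (forall x, 0 <= f x) ->
  \int[mu]_x f (x + a : E)%R = \int[mu]_x f x.

(* Both sides equal the double integral of [g x * f (x + y)] against
   [mu (dx) nu (dy)]; the substitutions [y -> y - x] and [x -> x - y] move the
   integration of [f] to [nu] and to [mu] respectively. *)
Lemma translation_invariant_unique
    (mu nu : {sigma_finite_measure set (euclid dot) -> \bar R})
    (g f : euclid dot -> \bar R) :
  translation_invariant mu -> translation_invariant nu ->
  measurable_fun setT g -> (forall x, 0 <= g x) ->
    (forall x : E, g (- x)%R = g x) ->
  \int[mu]_x g x = 1 -> \int[nu]_x g x = 1 ->
  measurable_fun setT f -> (forall x, 0 <= f x) ->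
  \int[nu]_x f x = \int[mu]_x f x.
Proof.
move=> imu inu mg g0 gN mu1 nu1 mf f0.
have mfst : measurable_fun setT (fun p : euclid dot * euclid dot => g p.1).
  exact: measurableT_comp.
transitivity (\int[mu]_x \int[nu]_y (g x * f (y + x : E)%R)).
  rewrite -[LHS]mul1e -mu1 -ge0_integralZr//; last exact: integral_ge0.
  apply: eq_integral => x _; rewrite -(inu x f)// -ge0_integralZl//.
  exact: (measurableT_comp mf (measurable_shift_euclid _)).
have madd : measurable_fun setT
    ((fun p => p.2 + p.1 : E)%R : euclid dot * euclid dot -> euclid dot).
  by apply: (@measurable_add_euclid _ (euclid dot * euclid dot)%type snd fst).
have msub : measurable_fun setT
    ((fun p => p.1 - p.2 : E)%R : euclid dot * euclid dot -> euclid dot).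
  apply: (@measurable_add_euclid _ (euclid dot * euclid dot)%type fst) => //.
  exact: (@measurable_opp_euclid _ (euclid dot * euclid dot)%type snd).
have mh : measurable_fun setT
  (fun p : euclid dot * euclid dot => g p.1 * f (p.2 + p.1 : E)%R).
  exact: emeasurable_funM mfst (measurableT_comp mf madd).
have mk : measurable_fun setT
  (fun p : euclid dot * euclid dot => g (p.1 - p.2 : E)%R * f p.1).
  by apply: emeasurable_funM (measurableT_comp mg msub) _;
    exact: measurableT_comp.
have := @fubini_tonelli _ _ _ _ _ mu nu
  (fun p : euclid dot * euclid dot => g p.1 * f (p.2 + p.1 : E)%R) mh
  (fun p => mule_ge0 (g0 _) (f0 _)).
rewrite /fubini_F /fubini_G /= => ->.
transitivity (\int[nu]_y \int[mu]_x (g (x - y : E)%R * f x)).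
  apply: eq_integral => y _.
  rewrite -[RHS](imu y)//.
  - by apply: eq_integral => x _; rewrite addrK addrC.
  - exact: (measurableT_comp mk (pair2_measurable y)).
  - by move=> x; rewrite mule_ge0.
have := @fubini_tonelli _ _ _ _ _ mu nu
  (fun p : euclid dot * euclid dot => g (p.1 - p.2 : E)%R * f p.1) mk
  (fun p => mule_ge0 (g0 _) (f0 _)).
rewrite /fubini_F /fubini_G /= => <-.
apply: eq_integral => x _.
rewrite ge0_integralZr//; last first.
  exact: (measurableT_comp mg (measurable_reflect_euclid _)).
(* Evenness turns [g (x - y)] into [g (y - x)], a translate of [g] in [y], whose [nu]-integral is
   [1]. *)
rewrite -[RHS]mul1e -nu1 -(inu (- x)%R g)//; congr (_ * _).
by apply: eq_integral => y _; rewrite -gN opprB.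
Qed.

End LebesgueEuclid.

Lemma measurable_linear {R : realType} {E F : vectType R}
    (dE : {dot E for idfun})
    (dF : {dot F for idfun}) (L : {linear E -> F}) :
  measurable_fun setT (L : euclid dE -> euclid dF).
Proof.
apply: measurable_to_euclid => i.
rewrite (_ : (fun _ => _) =
  (fun x => \sum_j tnth (coord_of dE x) j * dF (L (tnth (onb dE) j))
  (tnth (onb dF) i))).
  apply: measurable_sum => j; apply: measurable_funM;
    last exact: measurable_cst.
  exact: measurable_coord.
apply/funext => x; rewrite tnth_mktuple -{1}(coord_ofK dE x)
  linear_sum linear_sumlz/=.
by apply: eq_bigr => j _; rewrite linearZ/= linearZl_LR.
Qed.

(** * Orthogonal decompositions *)

Section OrthogonalDecomposition.
Context {R : realType} {H : vectType R} (dot : {dot H for idfun}).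
Context (U V : {vspace H}).
Hypotheses (hsum : (U + V)%VS = fullv) (horth : (U <= orthov dot V)%VS).
Local Notation dotU := (subdot dot U).
Local Notation dotV := (subdot dot V).

Lemma capv_orthov (W : {vspace H}) : (W :&: orthov dot W)%VS = 0%VS.
Proof.
apply/eqP; rewrite -subv0; apply/subvP => x;
  rewrite memv_cap memv0 => /andP[xW /mem_orthovP xO].
by apply: contraTT isT => /(@neq0_dnorm_gt0 _ _ _ dot); rewrite (xO x xW) ltxx.
Qed.

Lemma orth_proj_id (W : {vspace H}) (x : subvs_of W) :
  orth_proj dot W (vsval x) = x.
Proof.
by rewrite /orth_proj daddv_pi_id ?capv_orthov ?subvsP// vsvalK.
Qed.

Lemma orth_proj_orthov (W : {vspace H}) (x : H) :
  x \in orthov dot W -> orth_proj dot W x = 0.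
Proof.
move=> xO; rewrite /orth_proj.
have xW : x \in (W + orthov dot W)%VS by rewrite -[x]add0r memv_add ?mem0v.
(* The two projections of [x] add up to [x], and the one onto [orthov dot W] already equals [x], so
   the other vanishes. *)
have := daddv_pi_add (capv_orthov W) xW.
rewrite [X in _ + X]daddv_pi_id//; last by rewrite capvC capv_orthov.
by move/(congr1 (fun z => z - x)); rewrite addrK subrr => ->; rewrite linear0.
Qed.

Lemma orth_projD (W : {vspace H}) (x y : H) :
  orth_proj dot W (x + y) = orth_proj dot W x + orth_proj dot W y.
Proof. by rewrite /orth_proj !linearD. Qed.

Lemma measurable_orth_proj (W : {vspace H}) :
  measurable_fun setT (orth_proj dot W : euclid dot -> euclid (subdot dot W)).
Proof.
exact: (measurable_linear dot (subdot dot W)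
  (vsproj W \o daddv_pi W (orthov dot W))).
Qed.

Definition sum_pair (p : euclid dotU * euclid dotV) : euclid dot :=
  vsval (p.1 : subvs_of U) + vsval (p.2 : subvs_of V).

Definition proj_pair (x : euclid dot) : euclid dotU * euclid dotV :=
  (orth_proj dot U x, orth_proj dot V x).

Lemma orth_proj_sum_pairl p : orth_proj dot U (sum_pair p) = p.1.
Proof.
rewrite /sum_pair orth_projD orth_proj_id orth_proj_orthov ?addr0//.
by apply: (subvP _ _ (subvsP _)); rewrite orthov_sym.
Qed.

Lemma orth_proj_sum_pairr p : orth_proj dot V (sum_pair p) = p.2.
Proof.
rewrite /sum_pair orth_projD orth_proj_id orth_proj_orthov ?add0r//.
exact: (subvP horth _ (subvsP _)).
Qed.

Lemma sum_pairK : cancel sum_pair proj_pair.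
Proof.
by case=> u v; rewrite /proj_pair orth_proj_sum_pairl orth_proj_sum_pairr.
Qed.

Lemma sum_pair_surj (x : H) : exists p, sum_pair p = x.
Proof.
have : x \in (U + V)%VS by rewrite hsum memvf.
case/memv_addP => u uU [v vV ->]; exists (vsproj U u, vsproj V v).
by rewrite /sum_pair/= !vsprojK.
Qed.

Lemma measurable_sum_pair : measurable_fun setT sum_pair.
Proof.
apply: (@measurable_add_euclid R H dot _ (euclid dotU * euclid dotV)%type
  (fun p => vsval (p.1 : subvs_of U)) (fun p => vsval (p.2 : subvs_of V))).
- exact: (measurableT_comp (measurable_linear dotU dot vsval) measurable_fst).
- exact: (measurableT_comp (measurable_linear dotV dot vsval) measurable_snd).
Qed.

Lemma measurable_proj_pair : measurable_fun setT proj_pair.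
Proof. by apply: measurable_fun_pair; exact: measurable_orth_proj. Qed.

(** Pythagoras splits the exponent, and additivity of dimensions splits the power of [2 * pi]. *)
Lemma std_normal_pdf_sum_pair p :
  std_normal_pdf (sum_pair p) = std_normal_pdf p.1 * std_normal_pdf p.2.
Proof.
case: p => u v; rewrite /std_normal_pdf /=.
have UV0 : (U :&: V)%VS = 0%VS.
  by apply/eqP; rewrite -subv0 -(capv_orthov V) capvC capvS.
have -> : \dim {:H} = (\dim {: subvs_of U} + \dim {: subvs_of V})%N.
  by rewrite -hsum dimv_disjoint_sum// !dimvf.
have normE : enorm dot (sum_pair (u, v)) ^+ 2 =
  enorm dotU u ^+ 2 + enorm dotV v ^+ 2.
  have [uu vv] := (dot_ge0 dotU u, dot_ge0 dotV v).
  rewrite /enorm !sqr_sqrtr ?dot_ge0// /subdot.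
  have uv := orthovP horth _ _ (subvsP u) (subvsP v).
  by rewrite /sum_pair/= linearDl !linearDr/= (dotC dot (vsval v) (vsval u))
    uv addr0 add0r.
have c0 : (2 * pi : R) != 0 by rewrite mulf_neq0 ?pnatr_eq0// gt_eqF ?pi_gt0.
move: (2 * pi) c0 => c c0;
  rewrite normE natrD !mulrDl !opprD powRD ?c0 ?implybT//.
by rewrite expRD mulrACA.
Qed.

Local Open Scope ereal_scope.
Local Notation leb := (@lebesgue_euclid R H dot).
Local Notation lebU := (@lebesgue_euclid R (subvs_of U) dotU).
Local Notation lebV := (@lebesgue_euclid R (subvs_of V) dotV).

(** The bases picked for [H], [U] and [V] are unrelated, so coordinates cannot be compared directly.
    Instead the image [nu] of the product measure under [sum_pair] is shown to satisfy the
    hypotheses of [translation_invariant_unique], with the normal density as the even function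
    [g]. *)
Lemma ge0_integral_lebesgue_euclid_prod (f : euclid dot -> \bar R) :
  measurable_fun setT f -> (forall x, 0 <= f x) ->
  \int[leb]_x f x = \int[lebU \x lebV]_p f (sum_pair p).
Proof.
move=> mf f0.
pose push := pushforward_measure (lebU \x lebV) sum_pair measurable_sum_pair.
have [|nu nuE] := sigma_finite_measureP push.
  exact: sigma_finite_pushforward measurable_proj_pair sum_pairK
    (sigma_finite_product _ _).
have intE (g : euclid dot -> \bar R) : measurable_fun setT g ->
  (forall x, 0 <= g x) ->
    \int[nu]_x g x = \int[lebU]_u \int[lebV]_v g (sum_pair (u, v)).
  move=> mg g0; rewrite -nuE /push /pushforward_measure/=
    ge0_integral_pushforward//; last exact: measurable_sum_pair.
  rewrite preimage_setT fubini_tonelli1//.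
    exact: measurableT_comp mg measurable_sum_pair.
  by move=> p; exact: g0.
have := @translation_invariant_unique R H dot leb nu
  (EFin \o @std_normal_pdf R H dot) f.
have msection (g : euclid dot -> \bar R) u : measurable_fun setT g ->
    measurable_fun setT (fun v => g (sum_pair (u, v))).
  by move=> mg; exact: (measurableT_comp
    (measurableT_comp mg measurable_sum_pair) (pair1_measurable u)).
move=> /(_ _ _ _ _ _ _ _ mf f0) <-.
- by rewrite -nuE /push /pushforward_measure/= ge0_integral_pushforward//;
    exact: measurable_sum_pair.
- exact: ge0_integral_lebesgue_euclid_shift.
(* A translation of [H] splits into its components [a1] and [a2], which are absorbed one in each
   factor of the product. *)
- move=> a g mg g0; have [[a1 a2] <-] := sum_pair_surj a.
  have mga b : measurable_fun setT (fun x : euclid dot => g (x + b : H)%R).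
    exact: (measurableT_comp mg (measurable_shift_euclid _ _)).
  rewrite !intE//.
  pose F u := \int[lebV]_v g (sum_pair (u, v)).
  rewrite -[RHS](ge0_integral_lebesgue_euclid_shift _ (a1 : subvs_of U) F).
  + apply: eq_integral => u _; rewrite /F.
    rewrite -[RHS](ge0_integral_lebesgue_euclid_shift _ (a2 : subvs_of V))//;
      last exact: msection.
    apply: eq_integral => v _; congr g; rewrite /sum_pair/=.
    by rewrite addrACA.
  + exact: (@measurable_fun_fubini_tonelli_F _ _ _ _ _ lebV (g \o sum_pair)
      (measurableT_comp mg measurable_sum_pair) (fun=> g0 _)).
  + by move=> u; exact: integral_ge0.
- by apply/measurable_EFinP; exact: measurable_std_normal_pdf.
- by move=> x; rewrite lee_fin std_normal_pdf_ge0.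
- by move=> x; rewrite /= std_normal_pdfN.
- exact: integral_std_normal_pdf.
- rewrite intE; last 2 first.
  + by apply/measurable_EFinP; exact: measurable_std_normal_pdf.
  + by move=> x; rewrite lee_fin std_normal_pdf_ge0.
  rewrite -(integral_std_normal_pdf dotU); apply: eq_integral => u _.
  rewrite -[RHS]mule1 -(integral_std_normal_pdf dotV) -ge0_integralZl//.
  + by apply: eq_integral => v _; rewrite /= std_normal_pdf_sum_pair.
  + by apply/measurable_EFinP; exact: measurable_std_normal_pdf.
  + by move=> x _; rewrite lee_fin std_normal_pdf_ge0.
  + by rewrite lee_fin std_normal_pdf_ge0.
Qed.

End OrthogonalDecomposition.

(** * Densities of the projections *)

Section Marginal.
Context {R : realType} {H : vectType R} (dot : {dot H for idfun}).
Context (U V : {vspace H}).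
Hypotheses (hsum : (U + V)%VS = fullv) (horth : (U <= orthov dot V)%VS).
Context {dT : measure_display} {T : measurableType dT} (P : probability T R).
Context (X : T -> euclid dot).
Local Notation dotU := (subdot dot U).
Local Notation dotV := (subdot dot V).
Local Notation projU := (orth_proj dot U : euclid dot -> euclid dotU).
Local Notation projV := (orth_proj dot V : euclid dot -> euclid dotV).
Local Open Scope ereal_scope.
Local Notation leb := (@lebesgue_euclid R H dot).
Local Notation lebU := (@lebesgue_euclid R (subvs_of U) dotU).
Local Notation lebV := (@lebesgue_euclid R (subvs_of V) dotV).

(** Evaluates the terms of the expanded square without [p], each of which is a function of one
    projection times a function of the other. *)
Lemma ge0_integral_proj_mul (h : euclid dotU -> \bar R)
    (k : euclid dotV -> \bar R) :
  measurable_fun setT h -> measurable_fun setT k ->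
  (forall u, 0 <= h u) -> (forall v, 0 <= k v) ->
  \int[leb]_x (h (projU x) * k (projV x)) = \int[lebU]_u h u * \int[lebV]_v k v.
Proof.
move=> mh mk h0 k0.
rewrite (ge0_integral_lebesgue_euclid_prod dot U V hsum horth); last 2 first.
- apply: emeasurable_funM.
    exact: measurableT_comp mh (measurable_orth_proj _ _).
  exact: measurableT_comp mk (measurable_orth_proj _ _).
- by move=> x; rewrite mule_ge0.
transitivity (\int[lebU \x lebV]_p (h p.1 * k p.2)).
  apply: eq_integral => p _.
  by rewrite orth_proj_sum_pairl// orth_proj_sum_pairr.
rewrite fubini_tonelli1//; last 2 first.
- apply: emeasurable_funM.
    exact: measurableT_comp mh measurable_fst.
  exact: measurableT_comp mk measurable_snd.
- by move=> p; rewrite mule_ge0.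
rewrite -ge0_integralZr//; last exact: integral_ge0.
by apply: eq_integral => u _; rewrite -ge0_integralZl.
Qed.

(** Extended-real valued, because the partial integral of a density may be infinite at some [u]. *)
Definition marginal (p : euclid dot -> R) (u : euclid dotU) : \bar R :=
  \int[lebV]_v (p (sum_pair dot U V (u, v)))%:E.

Section density.
Variable p : euclid dot -> R.
Hypotheses (mp : measurable_fun setT p) (p0 : forall x, (0 <= p x)%R).

Let mps : measurable_fun setT
  (fun q : euclid dotU * euclid dotV => (p (sum_pair dot U V q))%:E).
Proof.
apply/measurable_EFinP;
  exact: measurableT_comp mp (measurable_sum_pair dot U V).
Qed.

Lemma measurable_marginal : measurable_fun setT (marginal p).
Proof.
exact: (@measurable_fun_fubini_tonelli_F _ _ _ _ _ lebV
  (fun q : euclid dotU * euclid dotV => (p (sum_pair dot U V q))%:E)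
    mps (fun=> p0 _)).
Qed.

Lemma marginal_ge0 u : 0 <= marginal p u.
Proof. by apply: integral_ge0 => v _; rewrite lee_fin. Qed.

Lemma integral_marginal (h : euclid dotU -> \bar R) :
  measurable_fun setT h -> (forall u, 0 <= h u) ->
  \int[leb]_x ((p x)%:E * h (projU x)) = \int[lebU]_u (marginal p u * h u).
Proof.
move=> mh h0.
rewrite (ge0_integral_lebesgue_euclid_prod dot U V hsum horth); last 2 first.
- apply: emeasurable_funM; first exact/measurable_EFinP.
  exact: measurableT_comp mh (measurable_orth_proj _ _).
- by move=> x; rewrite mule_ge0// lee_fin.
transitivity (\int[lebU \x lebV]_q ((p (sum_pair dot U V q))%:E * h q.1)).
  by apply: eq_integral => q _; rewrite orth_proj_sum_pairl.
rewrite fubini_tonelli1//; last 2 first.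
- apply: emeasurable_funM => //; exact: measurableT_comp mh measurable_fst.
- by move=> q; rewrite mule_ge0// lee_fin.
apply: eq_integral => u _; rewrite /fubini_F /= ge0_integralZr//.
- apply/measurable_EFinP; apply: (measurableT_comp mp).
  exact: (measurableT_comp (measurable_sum_pair dot U V) (pair1_measurable u)).
- by move=> v _; rewrite lee_fin.
Qed.

End density.

Lemma marginal_distribution (p : euclid dot -> R) (A : set (euclid dotU)) :
  is_density P X p -> measurable A ->
  P ((projU \o X) @^-1` A) = \int[lebU]_(u in A) marginal p u.
Proof.
case=> mp p0 pE mA; rewrite comp_preimage pE; last first.
  by rewrite -[X in measurable X]setTI; exact: measurable_orth_proj.
rewrite integral_mkcond [RHS]integral_mkcond !epatch_indic.
rewrite -(integral_marginal p mp p0 (fun u => (\1_A u)%:E))//.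
exact/measurable_EFinP.
Qed.

Lemma integral_marginal_eq1 (p : euclid dot -> R) : is_density P X p ->
  \int[lebU]_u marginal p u = 1.
Proof.
by move=> dp; rewrite -marginal_distribution// preimage_setT probability_setT.
Qed.

Lemma integrable_marginal (p : euclid dot -> R) : is_density P X p ->
  lebU.-integrable setT (marginal p).
Proof.
move=> dp; have [mp p0 _] := dp; apply/integrableP; split;
  first exact: measurable_marginal.
under eq_integral do rewrite gee0_abs ?marginal_ge0//.
by rewrite integral_marginal_eq1// ltry.
Qed.

(** Keeps the projection out of the branch where [chi2_normal] is [+oo] by convention. The marginal
    has integral [1], hence is finite almost everywhere, and [fine] alters it only on a null set. *)
Lemma density_proj_exists (p : euclid dot -> R) : is_density P X p ->
  exists a, is_density P (projU \o X) a.
Proof.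
move=> dp; have [mp p0 _] := dp; have mq := measurable_marginal p mp p0.
have mfq : measurable_fun setT (fine \o marginal p) by exact: measurableT_comp.
exists (fine \o marginal p); split=> // [u|A mA].
  by rewrite /= fine_ge0 ?marginal_ge0.
rewrite (marginal_distribution p)//; apply: ge0_ae_eq_integral => //.
- exact: measurable_funTS.
- by apply: measurable_funTS; exact/measurable_EFinP.
- by move=> u _; exact: marginal_ge0.
- by move=> u _; rewrite lee_fin fine_ge0 ?marginal_ge0.
have := integrable_ae measurableT (integrable_marginal p dp).
by apply: filterS => u /(_ I) qu Au; rewrite /= fineK.
Qed.

(** Here [a] is any density of the projection. It has the same integral as the marginal over every
    measurable set, so the two agree almost everywhere. *)
Lemma integral_density_proj (p : euclid dot -> R) (a : euclid dotU -> R)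
    (h : euclid dotU -> \bar R) :
  is_density P X p -> is_density P (projU \o X) a ->
  measurable_fun setT h -> (forall u, 0 <= h u) ->
  \int[leb]_x ((p x)%:E * h (projU x)) = \int[lebU]_u ((a u)%:E * h u).
Proof.
move=> dp [ma a0 aE] mh h0; have [mp p0 _] := dp.
rewrite integral_marginal//; apply: ge0_ae_eq_integral => //.
- by apply: emeasurable_funM => //; exact: measurable_marginal.
- by apply: emeasurable_funM => //; exact/measurable_EFinP.
- by move=> u _; rewrite mule_ge0 ?marginal_ge0.
- by move=> u _; rewrite mule_ge0 ?lee_fin.
have : ae_eq lebU setT (marginal p) (EFin \o a).
  apply: integral_ae_eq => //; first exact: integrable_marginal.
    exact/measurable_EFinP.
  by move=> A _ mA; rewrite -marginal_distribution// aE.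
by apply: filterS => u /(_ I) /= -> _.
Qed.

End Marginal.

(** * The chi-square divergence *)

Section NonnegMeasurable.
Context {d} {T : measurableType d} {R : realType}
  (mu : {measure set T -> \bar R}).

(** The class on which integrals are additive and monotone even when they are infinite. *)
Definition nonneg_measurable (f : T -> R) :=
  measurable_fun setT f /\ forall x, 0 <= f x.

Lemma nonneg_measurableD f g : nonneg_measurable f -> nonneg_measurable g ->
  nonneg_measurable (fun x => f x + g x).
Proof.
by move=> [mf f0] [mg g0]; split=> [|x];
  [exact: measurable_funD|exact: addr_ge0].
Qed.

Lemma nonneg_measurableM f g : nonneg_measurable f -> nonneg_measurable g ->
  nonneg_measurable (fun x => f x * g x).
Proof.
by move=> [mf f0] [mg g0]; split=> [|x];
  [exact: measurable_funM|exact: mulr_ge0].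
Qed.

Lemma nonneg_measurableV f :
  nonneg_measurable f -> nonneg_measurable (fun x => (f x)^-1).
Proof.
move=> [mf f0]; split=> [|x]; last by rewrite invr_ge0.
(* On nonnegative reals inversion is the power [-1], also at [0], where both take the default value
   [0]. *)
rewrite (_ : (fun _ => _) = (@powR R ^~ (-1)) \o f).
  by apply: measurableT_comp => //; exact: measurable_powR.
by apply/funext => x /=; rewrite powR_inv1.
Qed.

Lemma nonneg_measurable_EFin f : nonneg_measurable f ->
  measurable_fun setT (EFin \o f) /\ forall x, (0 <= (f x)%:E)%E.
Proof.
by move=> [mf f0]; split=> [|x]; [exact/measurable_EFinP|rewrite lee_fin].
Qed.

Lemma integralD_nonneg f g : nonneg_measurable f -> nonneg_measurable g ->
  (\int[mu]_x (f x + g x)%:E = \int[mu]_x (f x)%:E + \int[mu]_x (g x)%:E)%E.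
Proof.
move=> /nonneg_measurable_EFin[mf f0] /nonneg_measurable_EFin[mg g0].
by under eq_integral do rewrite EFinD; exact: ge0_integralD.
Qed.

Lemma le_integral_nonneg f g : nonneg_measurable f -> nonneg_measurable g ->
  (forall x, f x <= g x) -> (\int[mu]_x (f x)%:E <= \int[mu]_x (g x)%:E)%E.
Proof.
move=> /nonneg_measurable_EFin[mf f0] /nonneg_measurable_EFin[mg g0] fg.
by apply: ge0_le_integral => // x _; rewrite lee_fin.
Qed.

End NonnegMeasurable.

Section ChiSquare.
Context {R : realType} {H : vectType R} (dot : {dot H for idfun}).
Context (U V : {vspace H}).
Hypotheses (hsum : (U + V)%VS = fullv) (horth : (U <= orthov dot V)%VS).
Context {dT : measure_display} {T : measurableType dT} (P : probability T R).
Context (X : T -> euclid dot).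
Local Notation dotU := (subdot dot U).
Local Notation dotV := (subdot dot V).
Local Notation projU := (orth_proj dot U : euclid dot -> euclid dotU).
Local Notation projV := (orth_proj dot V : euclid dot -> euclid dotV).
Local Notation leb := (@lebesgue_euclid R H dot).
Local Notation lebU := (@lebesgue_euclid R (subvs_of U) dotU).
Local Notation lebV := (@lebesgue_euclid R (subvs_of V) dotV).
Local Notation phi := (@std_normal_pdf R H dot).
Local Notation phiU := (@std_normal_pdf R (subvs_of U) dotU).
Local Notation phiV := (@std_normal_pdf R (subvs_of V) dotV).

Lemma nonneg_measurable_std_normal_pdf {F : vectType R}
    (dF : {dot F for idfun}) :
  nonneg_measurable (@std_normal_pdf R F dF).
Proof.
by split=> [|x]; [exact: measurable_std_normal_pdf|exact: std_normal_pdf_ge0].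
Qed.

Lemma nonneg_measurable_density {F : vectType R} (dF : {dot F for idfun})
    (Y : T -> euclid dF) p :
  is_density P Y p -> nonneg_measurable p.
Proof. by case. Qed.

Lemma nonneg_measurable_proj (W : {vspace H}) (f : euclid (subdot dot W) -> R) :
  nonneg_measurable f ->
  nonneg_measurable (fun x : euclid dot => f (orth_proj dot W x)).
Proof.
move=> [mf f0]; split=> //;
  exact: (measurableT_comp mf (measurable_orth_proj dot W)).
Qed.

Lemma nonneg_measurable_chi2 {F : vectType R} (dF : {dot F for idfun})
    (f : euclid dF -> R) :
  nonneg_measurable f ->
  nonneg_measurable (fun x => f x ^+ 2 / std_normal_pdf x).
Proof.
move=> nf; under eq_fun do rewrite expr2.
apply: nonneg_measurableM; first exact: nonneg_measurableM.
exact/nonneg_measurableV/nonneg_measurable_std_normal_pdf.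
Qed.

Lemma std_normal_pdf_proj x : phi x = phiU (projU x) * phiV (projV x).
Proof.
have [q <-] := sum_pair_surj dot U V hsum x.
by rewrite std_normal_pdf_sum_pair// orth_proj_sum_pairl// orth_proj_sum_pairr.
Qed.

Lemma integral_density1 {F : vectType R} (dF : {dot F for idfun})
    (Y : T -> euclid dF) p :
  is_density P Y p -> (\int[@lebesgue_euclid R F dF]_x (p x)%:E = 1)%E.
Proof. by case=> _ _ pE; rewrite -pE// preimage_setT probability_setT. Qed.

Lemma integral_proj_mul (h : euclid dotU -> R) (k : euclid dotV -> R) :
  nonneg_measurable h -> nonneg_measurable k ->
  (\int[leb]_x (h (projU x) * k (projV x))%:E =
    \int[lebU]_u (h u)%:E * \int[lebV]_v (k v)%:E)%E.
Proof.
move=> /nonneg_measurable_EFin[mh h0] /nonneg_measurable_EFin[mk k0].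
rewrite -(ge0_integral_proj_mul dot U V hsum horth (EFin \o h) (EFin \o k))//.
Qed.

Context (p : euclid dot -> R) (a : euclid dotU -> R).
Hypotheses (dp : is_density P X p) (da : is_density P (projU \o X) a).

Lemma integral_density_proj_mul (h : euclid dotU -> R) : nonneg_measurable h ->
  (\int[leb]_x (p x * h (projU x))%:E = \int[lebU]_u (a u * h u)%:E)%E.
Proof.
move=> /nonneg_measurable_EFin[mh h0].
exact: (integral_density_proj dot U V hsum horth P X p a (EFin \o h) dp da).
Qed.

Local Open Scope ereal_scope.

(* The truncation makes the left-hand side finite, so that it can be cancelled
   from [2 I <= F + I], the integrated form of
   [0 <= phi * (p / phi - g / phiU) ^ 2] with [g = a * \1_D]. *)
Lemma truncated_chi2_proj_le (n : nat) :
  \int[lebU]_(u in [set u | (a u <= n%:R * phiU u)%R]) (a u ^+ 2 / phiU u)%:E <=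
  \int[leb]_x (p x ^+ 2 / phi x)%:E.
Proof.
set D := [set u | _].
have nphi := nonneg_measurable_std_normal_pdf dotU.
have na := nonneg_measurable_density _ _ _ da.
have np := nonneg_measurable_density _ _ _ dp.
have mD : measurable D.
  rewrite -[D]setTI; apply: measurable_fun_le => //; first by case: na.
  by apply: measurable_funM; [exact: measurable_cst|case: nphi].
pose g u := (a u * \1_D u)%R.
have ng : nonneg_measurable g.
  apply: nonneg_measurableM na _; split=> //.
(* Idempotence of the indicator: it makes the cross term with [p] equal to the second moment [I] of
   [g / phiU]. *)
have ag u : (a u * g u = g u ^+ 2)%R.
  by rewrite /g indicE expr2; case: (u \in D) => /=; ring.
have -> : \int[lebU]_(u in D) (a u ^+ 2 / phiU u)%:E =
  \int[lebU]_u (g u ^+ 2 / phiU u)%:E.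
  rewrite integral_mkcond epatch_indic; apply: eq_integral => u _.
  rewrite -EFinM /g expr2 indicE; congr EFin; case: (u \in D) => /=; ring.
set I := integral _ _ _.
have I_fin : I \is a fin_num.
  rewrite ge0_fin_numE; last by apply: integral_ge0 => u _;
    rewrite lee_fin divr_ge0 ?sqr_ge0 ?std_normal_pdf_ge0.
  (* On [D] the bound [a <= n * phiU] gives [a ^ 2 / phiU <= n * a], and [n * a] has integral
     [n]. *)
  apply: (@le_lt_trans _ _ (\int[lebU]_u (n%:R * a u)%:E)); last first.
    under eq_integral do rewrite EFinM.
    have [ma a0] := nonneg_measurable_EFin _ na.
    by rewrite ge0_integralZl ?lee_fin//= (integral_density1 _ _ _ da)
      mule1 ltry.
  apply: le_integral_nonneg; first exact: nonneg_measurable_chi2.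
    by apply: nonneg_measurableM na; split=> //; exact: measurable_cst.
  move=> u; rewrite /g indicE ler_pdivrMr ?std_normal_pdf_gt0//.
  have [Du|_] := boolP (u \in D).
    rewrite mulr1 mulrAC expr2 ler_wpM2r//; first by case: na.
    by move: Du; rewrite inE.
  by rewrite mulr0 expr0n/= mulr_ge0 ?std_normal_pdf_ge0// mulr_ge0//; case: na.
have nd : nonneg_measurable (fun u => g u / phiU u)%R.
  exact: nonneg_measurableM ng (nonneg_measurableV _ nphi).
have t1 : \int[leb]_x (p x * (g (projU x) / phiU (projU x)))%:E = I.
  rewrite (integral_density_proj_mul (fun u => g u / phiU u)%R)//.
  by apply: eq_integral => u _; rewrite mulrA ag.
have r2 :
    \int[leb]_x (g (projU x) ^+ 2 / phiU (projU x) * phiV (projV x))%:E = I.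
  rewrite (integral_proj_mul (fun u => g u ^+ 2 / phiU u)%R phiV).
  - by rewrite integral_std_normal_pdf mule1.
  - exact: nonneg_measurable_chi2.
  - exact: nonneg_measurable_std_normal_pdf.
have n1 : nonneg_measurable
  (fun x : euclid dot => p x * (g (projU x) / phiU (projU x)))%R.
  exact: nonneg_measurableM np (nonneg_measurable_proj _ _ nd).
have n2 : nonneg_measurable
  (fun x : euclid dot => g (projU x) ^+ 2 / phiU (projU x) * phiV (projV x))%R.
  apply: nonneg_measurableM.
    exact: nonneg_measurable_proj (nonneg_measurable_chi2 _ _ ng).
  exact: nonneg_measurable_proj (nonneg_measurable_std_normal_pdf _).
have n3 : nonneg_measurable (fun x : euclid dot => p x ^+ 2 / phi x)%R
  by exact: nonneg_measurable_chi2.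
have : I + I <= \int[leb]_x (p x ^+ 2 / phi x)%:E + I.
  rewrite -{1 2}t1 -r2 -!integralD_nonneg//.
  apply: le_integral_nonneg; try exact: nonneg_measurableD.
  move=> x; rewrite std_normal_pdf_proj.
  have := std_normal_pdf_gt0 dotU (projU x);
    have := std_normal_pdf_gt0 dotV (projV x).
  move: (phiU _) (phiV _) (g _) (p x) => y z b q z0 y0.
  rewrite -subr_ge0 (_ : _ - _ = (y * z) * (q / (y * z) - b / y) ^+ 2)%R.
    by rewrite mulr_ge0 ?sqr_ge0// mulr_ge0 ?ltW.
  by field; rewrite !gt_eqF.
by rewrite leeD2rE.
Qed.

(** Monotone convergence in the truncated bound: the sets [D n] exhaust the space because [phiU] is
    positive. Applied to both projections, this makes their integrals finite whenever that of [X]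
    is. *)
Lemma chi2_proj_le :
  \int[lebU]_u (a u ^+ 2 / phiU u)%:E <= \int[leb]_x (p x ^+ 2 / phi x)%:E.
Proof.
pose D n := [set u : euclid dotU | (a u <= n%:R * phiU u)%R].
have na := nonneg_measurable_density _ _ _ da.
have nphi := nonneg_measurable_std_normal_pdf dotU.
have [mf f0] := nonneg_measurable_EFin _ (nonneg_measurable_chi2 _ _ na).
have mD n : measurable (D n).
  rewrite -[D n]setTI; apply: measurable_fun_le => //; first by case: na.
  by apply: measurable_funM; [exact: measurable_cst|case: nphi].
have ndD : nondecreasing_seq D.
  move=> m n mn; apply/subsetPset => u /= Du; apply: le_trans Du _.
  by rewrite ler_wpM2r ?std_normal_pdf_ge0// ler_nat.
have DT : \bigcup_n D n = setT.
  apply/seteqP; split=> // u _; exists (Num.truncn (a u / phiU u)).+1 => //.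
  by rewrite /D/= -ler_pdivrMr ?std_normal_pdf_gt0// ltW// truncnS_gt.
have := @ge0_nondecreasing_set_cvg_integral _ _ _ D _ lebU ndD mD
  (fun n => measurable_funTS mf) (fun n u _ => f0 u).
rewrite DT => cvgD; rewrite -(cvg_lim _ cvgD)//.
apply: lime_le; first by apply/cvg_ex; eexists; exact: cvgD.
by apply: nearW => n; exact: truncated_chi2_proj_le.
Qed.

End ChiSquare.

Section ChiSquareSuperadditive.
Context {R : realType} {H : vectType R} (dot : {dot H for idfun}).
Context (U V : {vspace H}).
Hypotheses (hsum : (U + V)%VS = fullv) (horth : (U <= orthov dot V)%VS).
Context {dT : measure_display} {T : measurableType dT} (P : probability T R).
Context (X : T -> euclid dot).
Local Notation dotU := (subdot dot U).
Local Notation dotV := (subdot dot V).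
Local Notation projU := (orth_proj dot U : euclid dot -> euclid dotU).
Local Notation projV := (orth_proj dot V : euclid dot -> euclid dotV).
Local Notation leb := (@lebesgue_euclid R H dot).
Local Notation lebU := (@lebesgue_euclid R (subvs_of U) dotU).
Local Notation lebV := (@lebesgue_euclid R (subvs_of V) dotV).
Local Notation phi := (@std_normal_pdf R H dot).
Local Notation phiU := (@std_normal_pdf R (subvs_of U) dotU).
Local Notation phiV := (@std_normal_pdf R (subvs_of V) dotV).
Local Open Scope ereal_scope.
Context (p : euclid dot -> R) (a : euclid dotU -> R) (b : euclid dotV -> R).
Hypotheses (dp : is_density P X p) (da : is_density P (projU \o X) a)
  (db : is_density P (projV \o X) b).

(* The expanded square is rearranged so that all terms on both sides are
   nonnegative: no integrability is then needed. *)
Lemma chi2_integral_superadditive :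
  (\int[lebU]_u (a u ^+ 2 / phiU u)%:E - 1)
    + (\int[lebV]_v (b v ^+ 2 / phiV v)%:E - 1) <=
  \int[leb]_x (p x ^+ 2 / phi x)%:E - 1.
Proof.
have hsum' : (V + U)%VS = fullv by rewrite addvC.
have horth' : (V <= orthov dot U)%VS by rewrite orthov_sym.
have leA := chi2_proj_le dot U V hsum horth P X p a dp da.
have leB := chi2_proj_le dot V U hsum' horth' P X p b dp db.
have np := nonneg_measurable_density _ _ _ _ dp.
have na := nonneg_measurable_density _ _ _ _ da.
have nb := nonneg_measurable_density _ _ _ _ db.
have nU := nonneg_measurable_std_normal_pdf dotU.
have nV := nonneg_measurable_std_normal_pdf dotV.
have nphi := nonneg_measurable_std_normal_pdf dot.
have nra := nonneg_measurableM _ _ na (nonneg_measurableV _ nU).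
have nrb := nonneg_measurableM _ _ nb (nonneg_measurableV _ nV).
have nca := nonneg_measurable_chi2 _ _ na.
have ncb := nonneg_measurable_chi2 _ _ nb.
have ncp := nonneg_measurable_chi2 _ _ np.
have npU f := nonneg_measurable_proj dot U f.
have npV f := nonneg_measurable_proj dot V f.
(* In the expansion of the square, [t1] to [t4] are the terms with a minus sign, each occurring
   twice. Of those with a plus sign, [r2] and [r3] are [phi] times the squares of [a / phiU] and
   [b / phiV], and [r6] is [phi] times their product. *)
pose t1 (x : euclid dot) := (p x * (a (projU x) / phiU (projU x)))%R.
pose t2 (x : euclid dot) := (p x * (b (projV x) / phiV (projV x)))%R.
pose t3 (x : euclid dot) := (a (projU x) * phiV (projV x))%R.
pose t4 (x : euclid dot) := (phiU (projU x) * b (projV x))%R.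
pose r2 (x : euclid dot) :=
  (a (projU x) ^+ 2 / phiU (projU x) * phiV (projV x))%R.
pose r3 (x : euclid dot) :=
  (phiU (projU x) * (b (projV x) ^+ 2 / phiV (projV x)))%R.
pose r6 (x : euclid dot) := (a (projU x) * b (projV x))%R.
have nt1 : nonneg_measurable t1 := nonneg_measurableM _ _ np (npU _ nra).
have nt2 : nonneg_measurable t2 := nonneg_measurableM _ _ np (npV _ nrb).
have nt3 : nonneg_measurable t3 := nonneg_measurableM _ _ (npU _ na) (npV _ nV).
have nt4 : nonneg_measurable t4 := nonneg_measurableM _ _ (npU _ nU) (npV _ nb).
have nr2 : nonneg_measurable r2 := nonneg_measurableM _ _ (npU _ nca)
  (npV _ nV).
have nr3 : nonneg_measurable r3 := nonneg_measurableM _ _ (npU _ nU)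
  (npV _ ncb).
have nr6 : nonneg_measurable r6 := nonneg_measurableM _ _ (npU _ na) (npV _ nb).
have ea := integral_density1 P _ _ _ da.
have eb := integral_density1 P _ _ _ db.
have ep := integral_density1 P _ _ _ dp.
have eU := integral_std_normal_pdf dotU.
have eV := integral_std_normal_pdf dotV.
have ephi := integral_std_normal_pdf dot.
set A := integral lebU _ _ in leA *; set B := integral lebV _ _ in leB *.
set F := integral leb _ _ in leA leB *.
have et1 : \int[leb]_x (t1 x)%:E = A.
  rewrite (integral_density_proj_mul dot U V hsum horth P X p a dp da
    (fun u => a u / phiU u)%R)//.
  by apply: eq_integral => u _; rewrite mulrA -expr2.
have et2 : \int[leb]_x (t2 x)%:E = B.
  rewrite (integral_density_proj_mul dot V U hsum' horth' P X p b dp db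
    (fun u => b u / phiV u)%R)//.
  by apply: eq_integral => u _; rewrite mulrA -expr2.
have prodE := integral_proj_mul dot U V hsum horth.
have et3 : \int[leb]_x (t3 x)%:E = 1 by rewrite (prodE a phiV)// ea eV mule1.
have et4 : \int[leb]_x (t4 x)%:E = 1 by rewrite (prodE phiU b)// eb eU mule1.
have er2 : \int[leb]_x (r2 x)%:E = A.
  by rewrite (prodE (fun u => a u ^+ 2 / phiU u)%R phiV)// eV mule1.
have er3 : \int[leb]_x (r3 x)%:E = B.
  by rewrite (prodE phiU (fun u => b u ^+ 2 / phiV u)%R)// eU mul1e.
have er6 : \int[leb]_x (r6 x)%:E = 1 by rewrite (prodE a b)// ea eb mule1.
have nSl := nonneg_measurableD _ _ nt1 nt2;
  have nSr := nonneg_measurableD _ _ nt3 nt4.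
have nS := nonneg_measurableD _ _ nSl nSr.
have eS : \int[leb]_x ((t1 x + t2 x) + (t3 x + t4 x))%:E = (A + B) + (1 + 1).
  rewrite (integralD_nonneg leb _ _ nSl nSr) (integralD_nonneg leb _ _ nt1 nt2).
  by rewrite (integralD_nonneg leb _ _ nt3 nt4) et1 et2 et3 et4.
have nQ1 := nonneg_measurableD _ _ ncp nphi;
  have nQ2 := nonneg_measurableD _ _ np np.
have nQ3 := nonneg_measurableD _ _ nr2 nr3;
  have nQ4 := nonneg_measurableD _ _ nr6 nr6.
have nQl := nonneg_measurableD _ _ nQ1 nQ2;
  have nQr := nonneg_measurableD _ _ nQ3 nQ4.
have eQ : \int[leb]_x (((p x ^+ 2 / phi x + phi x) + (p x + p x)) +
    ((r2 x + r3 x) + (r6 x + r6 x)))%:E =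
    ((F + 1) + (1 + 1)) + ((A + B) + (1 + 1)).
  rewrite (integralD_nonneg leb _ _ nQl nQr) (integralD_nonneg leb _ _ nQ1 nQ2).
  rewrite (integralD_nonneg leb _ _ nQ3 nQ4)
    (integralD_nonneg leb _ _ ncp nphi).
  rewrite (integralD_nonneg leb _ _ np np) (integralD_nonneg leb _ _ nr2 nr3).
  by rewrite (integralD_nonneg leb _ _ nr6 nr6) er2 er3 er6 ephi ep.
(* Twice the negative terms against the positive ones. Cancelling one copy of [A + B + 2] leaves
   [A + B <= F + 1], which is the claim. *)
have key : ((A + B) + (1 + 1)) + ((A + B) + (1 + 1)) <=
    ((F + 1) + (1 + 1)) + ((A + B) + (1 + 1)).
  rewrite -eQ -eS -(integralD_nonneg leb _ _ nS nS).
  apply: le_integral_nonneg;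
    [exact: nonneg_measurableD|exact: nonneg_measurableD|].
  move=> x; rewrite /t1 /t2 /t3 /t4 /r2 /r3 /r6
    (std_normal_pdf_proj dot U V hsum horth).
  have := std_normal_pdf_gt0 dotU (projU x);
    have := std_normal_pdf_gt0 dotV (projV x).
  move: (phiU _) (phiV _) (a _) (b _) (p x) => y z c e q z0 y0.
  rewrite -subr_ge0 (_ : _ - _ =
    (y * z) * (q / (y * z) - c / y - e / z + 1) ^+ 2)%R.
    by rewrite mulr_ge0 ?sqr_ge0// mulr_ge0 ?ltW.
  by field; rewrite !gt_eqF.
have A0 : 0 <= A by apply: integral_ge0 => u _; rewrite lee_fin; case: nca.
have B0 : 0 <= B by apply: integral_ge0 => v _; rewrite lee_fin; case: ncb.
(* If [F] is finite, [leA] and [leB] make [A] and [B] finite, so [key] can be cancelled in the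
   reals; if [F] is [+oo], the bound is trivial. *)
move: A B F leA leB key A0 B0 {et1 et2 er2 er3 eS eQ} =>
  [A| |] [B| |] [F| |] //=.
- by move=> _ _; rewrite -!EFinD !lee_fin => *; lra.
- by move=> *; rewrite leey.
Qed.

End ChiSquareSuperadditive.

(** Hides the choice made by [cid]: of the density it picks, only the defining property is kept. *)
Lemma chi2_normal_cases {R : realType} {H : vectType R}
    (dot : {dot H for idfun})
    {dT : measure_display} {T : measurableType dT} (P : probability T R)
    (Y : T -> euclid dot) :
  (exists2 p, is_density P Y p & (chi2_normal dot P Y =
     \int[@lebesgue_euclid R H dot]_x (p x ^+ 2 / std_normal_pdf x)%:E - 1)%E)
  \/
  ((forall p, ~ is_density P Y p) /\ chi2_normal dot P Y = +oo%E).
Proof.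
rewrite /chi2_normal; case: pselect => [h|/forallNP nh]; last by right.
by left; exists (sval (cid h)) => //; exact: svalP.
Qed.

Theorem proposition10p1 (R : realType) (H : vectType R)
    (dot : {dot H for idfun})
    (dT : measure_display) (T : measurableType dT) (P : probability T R)
    (X : {RV P >-> euclid dot})
    (H' H'' : {vspace H})
    (hsum : (H' + H'')%VS = fullv)
    (horth : (H' <= orthov dot H'')%VS)
    (hd1 : (1 <= \dim H')%N) (hd2 : (1 <= \dim H'')%N) :
  (chi2_normal (subdot dot H') P (fun w => orth_proj dot H' (X w))
   + chi2_normal (subdot dot H'') P (fun w => orth_proj dot H'' (X w))
   <= chi2_normal dot P X)%E.
Proof.
case: (chi2_normal_cases dot P X) => [[p dp ->]|[_ ->]]; last by rewrite leey.
have hsum' : (H'' + H')%VS = fullv by rewrite addvC.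
have horth' : (H'' <= orthov dot H')%VS by rewrite orthov_sym.
(* Once [X] has a density, so do both projections, which excludes the infinite branch on the
   left-hand side. *)
have [a0 da0] := density_proj_exists dot H' H'' hsum horth P X p dp.
have [b0 db0] := density_proj_exists dot H'' H' hsum' horth' P X p dp.
case: (chi2_normal_cases (subdot dot H') P (fun w => orth_proj dot H' (X w))) =>
  [[a da ->]|[/(_ a0)//]].
case: (chi2_normal_cases (subdot dot H'') P
  (fun w => orth_proj dot H'' (X w))) => [[b db ->]|[/(_ b0)//]].
exact: (chi2_integral_superadditive dot H' H'' hsum horth P X p a b dp da db).
Qed.
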